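(* Let $K$ be a commutative ring with unity and let $w\in A^*$ be a word with $l^*(w)=0$ (with $l^*$ computed over $K$). Then $|alph(w)|\le \lceil |w|/2\rceil$.
   Context: $A$ is a finite alphabet, $alph(w)$ the set of letters occurring in $w$, $|w|$ its length. $K\langle A\rangle$ is the free associative algebra over $K$ with scalar product $(P,Q)=\sum_u(P,u)(Q,u)$. The left normed Lie bracketing $l$: $l(\epsilon)=0$, $l(a)=a$, $l(ua)=l(u)a-a\,l(u)$, extended linearly; $l^*$ is the linear endomorphism with $(l^*(u),v)=(l(v),u)$ for all words $u,v$ (equivalently $l^*(\epsilon)=0$, $l^*(a)=a$, $l^*(aub)=l^*(au)b-l^*(ub)a$ for letters $a,b$). *)

(* Defs.v *)
From HB Require Import structures.
From mathcomp Require Import all_boot all_order all_algebra.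
From mathcomp Require Import finmap.
From mathcomp.multinomials Require Export monalg.

Set Implicit Arguments.
Unset Strict Implicit.
Unset Printing Implicit Defensive.

Import GRing.Theory.
Local Open Scope ring_scope.

(* Words over A are the elements of the free monoid {fmonom A}, with length
   fdeg; K<A> is its monoid algebra, in which << u >> is the word u.
   The ring K is nontrivial: over the zero ring every element of K<A> is 0.
   Nothing below needs K commutative. *)
Notation ncpoly K A := {malg K[{fmonom A}]}.

Definition alph (A : finType) (w : {fmonom A}) : {set A} :=
  [set a | a \in fmonom_val w].

Section LieBracketing.
Variables (K : nzRingType) (A : finType).
Implicit Types (a b c : A) (s t : seq A) (u v w : {fmonom A}).
Implicit Types (P Q : ncpoly K A) (f : {fmonom A} -> ncpoly K A).

Definition letter a : ncpoly K A := << FMonom [:: a] >>.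

(* The sum over all words reduces to the support of P. *)
Definition scal P Q : K := \sum_(u <- msupp P) P@_u * Q@_u.

Definition linext f P : ncpoly K A := \sum_(u <- msupp P) P@_u *: f u.

Definition lie_word u : ncpoly K A :=
  if fmonom_val u is a :: s
  then foldl (fun P b => P * letter b - letter b * P) (letter a) s
  else 0.

Definition lie : ncpoly K A -> ncpoly K A := linext lie_word.

(* Since lie_word v is homogeneous of degree |v|, the adjoint image of u only
   involves words of length |u|; scal_lstar is the defining property. *)
Definition lstar_word u : ncpoly K A :=
  \sum_(v : (fdeg u).-tuple A)
    scal (lie << FMonom v >>) << u >> *: << FMonom v >>.

Definition lstar : ncpoly K A -> ncpoly K A := linext lstar_word.

Lemma linextEw f (d : {fset {fmonom A}}) P : (msupp P `<=` d)%fset ->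
  linext f P = \sum_(u <- d) P@_u *: f u.
Proof.
move=> sPd; rewrite /linext (big_fset_incl _ sPd) // => u _ /mcoeff_outdom ->.
by rewrite scale0r.
Qed.

Lemma linext_is_linear f : linear (linext f).
Proof.
move=> c P Q; pose d := (msupp P `|` msupp Q)%fset.
rewrite (@linextEw f d) ?(@linextEw f d P) ?(@linextEw f d Q)
  ?fsubsetUl ?fsubsetUr //.
  rewrite scaler_sumr -big_split /=; apply: eq_bigr => u _.
  by rewrite mcoeffD mcoeffZ scalerDl scalerA.
by rewrite (fsubset_trans (msuppD_le _ _)) // fsetSU // msuppZ_le.
Qed.

Lemma linextU f u : linext f << u >> = f u.
Proof.
by rewrite /linext msuppU oner_eq0 big_seq_fset1 mcoeffUU scale1r.
Qed.

HB.instance Definition _ := GRing.isLinear.Build K (ncpoly K A) (ncpoly K A)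
  *:%R lie (linext_is_linear lie_word).

HB.instance Definition _ := GRing.isLinear.Build K (ncpoly K A) (ncpoly K A)
  *:%R lstar (linext_is_linear lstar_word).

Lemma scalU P u : scal P << u >> = P@_u.
Proof.
rewrite /scal; case: (boolP (u \in msupp P)) => [uP|uP].
  rewrite (big_fsetD1 u) //= mcoeffUU mulr1 big_seq big1 ?addr0 // => v.
  by rewrite !inE => /andP[vu _]; rewrite mcoeffU eq_sym (negPf vu) mulr0.
rewrite mcoeff_outdom // big_seq big1 // => v vP.
by rewrite mcoeffU; case: eqP vP uP => [-> ->|_ _ _] //; rewrite mulr0.
Qed.

Lemma lieU u : lie << u >> = lie_word u.
Proof. exact: linextU. Qed.

Lemma lstarU u : lstar << u >> = lstar_word u.
Proof. exact: linextU. Qed.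

Lemma lie_nil : lie << FMonom [::] >> = 0.
Proof. exact: lieU. Qed.

Lemma lie_letter a : lie (letter a) = letter a.
Proof. exact: lieU. Qed.

Lemma lie_rcons s a : s != [::] ->
  lie << FMonom (rcons s a) >> =
    lie << FMonom s >> * letter a - letter a * lie << FMonom s >>.
Proof.
by rewrite !lieU /lie_word; case: s => //= b s _; rewrite foldl_rcons.
Qed.

Lemma FMonomM s t : mmul (FMonom s) (FMonom t) = FMonom (s ++ t).
Proof. by apply/eqP; rewrite fmP fmM. Qed.

Lemma FMonom_eq s t : (FMonom s == FMonom t) = (s == t).
Proof. by rewrite fmP. Qed.

Lemma letterM a s : letter a * << FMonom s >> = << FMonom (a :: s) >>.
Proof. by rewrite /letter malgM_def fgmulUU mulr1 FMonomM. Qed.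

Lemma mulr_letter a s : << FMonom s >> * letter a = << FMonom (rcons s a) >>.
Proof. by rewrite /letter malgM_def fgmulUU mulr1 FMonomM cats1. Qed.

Lemma mcoeff_mulr_letter P a u : (P * letter a)@_u =
  \sum_(v <- msupp P) P@_v *+ (FMonom (rcons v a) == u).
Proof.
rewrite {1}[P]monalgE mulr_suml raddf_sum; apply: eq_bigr => -[s] _ /=.
by rewrite /letter malgM_def fgmulUU mulr1 FMonomM cats1 mcoeffU.
Qed.

Lemma mcoeff_letterM P a u : (letter a * P)@_u =
  \sum_(v <- msupp P) P@_v *+ (FMonom (a :: v) == u).
Proof.
rewrite {1}[P]monalgE mulr_sumr raddf_sum; apply: eq_bigr => -[s] _ /=.
by rewrite /letter malgM_def fgmulUU mul1r FMonomM mcoeffU.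
Qed.

Lemma mcoeffMr_letter P a s b :
  (P * letter a)@_(FMonom (rcons s b)) = P@_(FMonom s) *+ (a == b).
Proof.
rewrite mcoeff_mulr_letter -scalU /scal -sumrMnl; apply: eq_bigr => -[t] _.
by rewrite mcoeffU mulr_natr -mulrnA mulnb !FMonom_eq eqseq_rcons eq_sym.
Qed.

Lemma mcoeffMl_letter P a s b :
  (letter a * P)@_(FMonom (b :: s)) = P@_(FMonom s) *+ (a == b).
Proof.
rewrite mcoeff_letterM -scalU /scal -sumrMnl; apply: eq_bigr => -[t] _.
by rewrite mcoeffU mulr_natr -mulrnA mulnb !FMonom_eq eqseq_cons andbC eq_sym.
Qed.

Lemma lie_homog s t :
  size s != size t -> (lie << FMonom s >>)@_(FMonom t) = 0.
Proof.
elim/last_ind: s t => [|s a IHs] t; first by rewrite lie_nil mcoeff0.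
have [-> /=|s0] := eqVneq s [::].
  rewrite lie_letter mcoeffU FMonom_eq.
  by case: (altP ([:: a] =P t)) => // <-; rewrite eqxx.
rewrite size_rcons lie_rcons // mcoeffB => st.
move: (lie _) IHs => P IHs.
rewrite [X in X - _]mcoeff_mulr_letter [X in _ - X]mcoeff_letterM.
rewrite big1 => [|[v] _].
  rewrite big1 => [|[v] _]; first exact: subrr.
  rewrite FMonom_eq; case: eqP => [vt|_]; last exact: mulr0n.
  rewrite IHs; first exact: mul0rn.
  by apply: contra st; rewrite -vt /= => /eqP ->.
rewrite FMonom_eq; case: eqP => [vt|_]; last exact: mulr0n.
rewrite IHs; first exact: mul0rn.
by apply: contra st; rewrite -vt size_rcons => /eqP ->.
Qed.

Lemma lstarE u v : (lstar << u >>)@_v = (lie << v >>)@_u.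
Proof.
rewrite lstarU /lstar_word raddf_sum /=; case: u v => [s] [t].
under eq_bigr => r _ do rewrite mcoeffZ scalU mcoeffU FMonom_eq.
have [st|st] := eqVneq (size t) (size s); last first.
  rewrite [RHS]lie_homog; last exact: st.
  apply: big1 => r _.
  case: eqP => [rt|_]; last exact: mulr0.
  by case/eqP: st; rewrite -rt size_tuple.
have tP : size t == fdeg (FMonom s) by rewrite st.
rewrite (bigD1 (Tuple tP)) //= eqxx [X in X + _]mulr1 [X in _ + X]big1.
  exact: addr0.
by move=> r; rewrite -val_eqE /= => /negPf ->; exact: mulr0.
Qed.

Lemma scal_lstar u v : scal (lstar << u >>) << v >> = scal (lie << v >>) << u >>.
Proof. by rewrite [LHS]scalU [RHS]scalU; apply: lstarE. Qed.

Lemma lstar_nil : lstar << FMonom [::] >> = 0.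
Proof.
apply/malgP => -[[|a s]]; rewrite lstarE mcoeff0; last exact: lie_homog.
by rewrite lie_nil mcoeff0.
Qed.

Lemma lstar_letter a : lstar (letter a) = letter a.
Proof.
apply/malgP => -[[|b [|c s]]]; rewrite lstarE.
- by rewrite lie_nil mcoeff0 /letter mcoeffU FMonom_eq.
- by rewrite (lie_letter b) /letter !mcoeffU eq_sym.
- by rewrite lie_homog // /letter mcoeffU FMonom_eq eqseq_cons andbF.
Qed.

Lemma lstar_cons_rcons a s b :
  lstar << FMonom (a :: rcons s b) >> =
    lstar << FMonom (a :: s) >> * letter b
    - lstar << FMonom (rcons s b) >> * letter a.
Proof.
apply/malgP => -[t]; rewrite mcoeffB [LHS]lstarE.
case: (lastP t) => [|{}t c].
  rewrite lie_nil mcoeff0 [X in X - _]mcoeff_mulr_letter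
    [X in _ - X]mcoeff_mulr_letter.
  have nil0 P d : \sum_(v <- msupp P) P@_v *+ (FMonom (rcons v d) == FMonom [::]) = 0.
    by apply: big1 => -[v] _; rewrite FMonom_eq; case: v => *; apply: mulr0n.
  by rewrite [X in X - _]nil0 [X in _ - X]nil0 [RHS]subrr.
rewrite [X in X - _]mcoeffMr_letter [X in _ - X]mcoeffMr_letter.
rewrite [X in X *+ _ - _]lstarE [X in _ - X *+ _]lstarE.
have [->|t0] := eqVneq t [::].
  rewrite lie_nil [X in X *+ _ - _]mcoeff0 [X in _ - X *+ _]mcoeff0.
  rewrite mul0rn mul0rn [RHS]subrr.
  by apply: lie_homog; rewrite /= size_rcons.
rewrite lie_rcons // mcoeffB; move: (lie _) => P.
rewrite [X in _ - X = _]mcoeffMl_letter -rcons_cons.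
rewrite [X in X - _ = _]mcoeffMr_letter.
by rewrite (eq_sym c) (eq_sym c).
Qed.

End LieBracketing.

(* Main.v *)
(* Write e(s) = 2 |alph s| - |s|.  If a letter x occurs exactly once in
   w = w1 x w2, the words of l^*(w) beginning with x form, up to sign, the
   polynomial x (rev w1 sh w2), where sh is the shuffle product; reversing,
   l^*(w) = 0 implies w1 sh rev w2 = 0.  A word with e(w) >= 2 has such a
   letter x, and e(w1 w2) = e(w) - 1 >= 1, so it suffices that u sh v = 0 over
   K implies e(u v) <= 0.  If y occurs once in v = v0 y v1 and not in u, then
   u sh v = 0 forces u sh v0 = u sh v1 = 0.  When e(u) and e(v) are positive,
   such a y exists in v or, symmetrically, in u, and e(u v0) + e(u v1) >=
   e(u v) - 1 + e(u) gives the induction step.  When e(u) <= 0 < e(u v), we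
   have 2 |alph v \ alph u| > |v|, and splitting v at such letters y reaches a
   factor v' with no letter of u, where u v' has coefficient 1 in u sh v'. *)
Require Import Defs.
From mathcomp Require Import all_boot all_order all_algebra.
From mathcomp Require Import zify.

Set Implicit Arguments.
Unset Strict Implicit.
Unset Printing Implicit Defensive.

Import GRing.Theory.
Local Open Scope ring_scope.

(** * Multiplicities in shuffle products *)

Section ShuffleCoefficients.
Variable A : eqType.
Implicit Types (a y z : A) (u v t : seq A).

(* The coefficient of t in the shuffle product of u and v. *)
Fixpoint shcoef u v t : nat :=
  if t is z :: t' then
    ((if u is a :: u' then (a == z) * shcoef u' v t' else 0) +
     (if v is b :: v' then (b == z) * shcoef u v' t' else 0))%N
  else nilp u && nilp v.

Lemma shcoefC u v t : shcoef u v t = shcoef v u t.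
Proof.
elim: t u v => [|z t IHt] u v /=; first by rewrite andbC.
by rewrite addnC; congr (_ + _)%N; [case: v|case: u] => // b s; rewrite IHt.
Qed.

Lemma shcoef_size u v t : shcoef u v t != 0%N -> (size u + size v)%N = size t.
Proof.
elim: t u v => [|z t IHt] u v /=; first by case: u v => [|? ?] [|? ?].
rewrite addn_eq0 negb_and => /orP[].
  by case: u => // a u; rewrite muln_eq0 negb_or => /andP[_ /IHt] /= <-.
case: v => // b v; rewrite muln_eq0 negb_or => /andP[_ /IHt] /= <-.
by rewrite addnS.
Qed.

Lemma shcoef_notin y u v t :
  y \in t -> y \notin u -> y \notin v -> shcoef u v t = 0%N.
Proof.
elim: t u v => //= z t IHt u v yzt yu yv.
have zP b s (F : nat) : y \notin b :: s -> (y \in t -> F = 0%N) ->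
    ((b == z) * F)%N = 0%N.
  rewrite inE negb_or => /andP[yb _] F0.
  move: yzt; rewrite inE => /orP[/eqP <-|/F0 ->]; last by rewrite muln0.
  by rewrite eq_sym (negPf yb).
have tl b (s : seq A) : y \notin b :: s -> y \notin s.
  by rewrite inE negb_or => /andP[].
case: u yu => [|a u] yu; case: v yv => [|b v] yv //=.
- by rewrite (zP _ _ _ yv) // => yt; apply: IHt => //; apply: tl yv.
- by rewrite (zP _ _ _ yu) // => yt; apply: IHt => //; apply: tl yu.
rewrite (zP _ _ _ yu) ?(zP _ _ _ yv) // => yt; apply: IHt => //.
  exact: tl yv.
exact: tl yu.
Qed.

Lemma shcoef_self u v : shcoef u v v = nilp u.
Proof.
elim: v u => [|b v IHv] u /=; first by rewrite andbT.
rewrite eqxx mul1n IHv; case: u => // a u.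
rewrite addn0; apply/eqP; apply: contraT.
by rewrite muln_eq0 negb_or => /andP[_ /shcoef_size /=]; lia.
Qed.

(** With disjoint alphabets every letter of the target reveals its factor, so only one interleaving
    reads [u ++ v]. *)
Lemma shcoef_cat u v : ~~ has (mem u) v -> shcoef u v (u ++ v) = 1%N.
Proof.
elim: u => [|a u IHu] uv; first exact: shcoef_self.
have uv' : ~~ has (mem u) v.
  by apply: contra uv; apply: sub_has => c /= cu; rewrite inE cu orbT.
rewrite /= eqxx mul1n IHu //; case: v uv {uv' IHu} => //= b v.
by rewrite inE !negb_or => /andP[/andP[/negPf -> _] _]; rewrite mul0n.
Qed.

(** The only y of the target comes from the only y of the second factor. Since [v1] then fills all
    the remaining places, [u] is used up inside [t]. *)
Lemma shcoef_suffix y u v0 v1 t :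
  y \notin u -> y \notin v0 -> y \notin v1 ->
  shcoef u (v0 ++ y :: v1) (t ++ y :: v1) = shcoef u v0 t.
Proof.
elim: t u v0 => [|z t IHt] u v0 yu yv0 yv1 /=.
  rewrite [X in (X + _)%N = _](_ : _ = 0%N) ?add0n; last first.
    case: u yu => // a u; rewrite inE negb_or eq_sym => /andP[/negPf -> _].
    by rewrite mul0n.
  case: v0 yv0 => [|b v0] /=; first by rewrite eqxx mul1n shcoef_self andbT.
  rewrite inE negb_or eq_sym => /andP[/negPf -> _].
  by rewrite mul0n andbF.
congr (_ + _)%N.
  by case: u yu => // a u; rewrite inE negb_or => /andP[_ yu]; rewrite IHt.
case: v0 yv0 => [|b v0] /=.
  (* Spending y on [z] leaves a later y that neither remaining factor contains. *)
  rewrite (@shcoef_notin y) ?muln0 //.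
  by rewrite mem_cat mem_head orbT.
by rewrite inE negb_or => /andP[_ yv0]; rewrite IHt.
Qed.

(** All of [v0] must be read before the first available y, so [s] has no room for letters of [u].
    The bound on [size s], weaker than [s = v0], survives the branch of the induction that reads a
    letter of [u]. *)
Lemma shcoef_prefix_le y u v0 v1 s t :
  y \notin u -> y \notin v0 -> (size s <= size v0)%N ->
  shcoef u (v0 ++ y :: v1) (s ++ y :: t) = ((s == v0) * shcoef u v1 t)%N.
Proof.
elim: s u v0 => [|z s IHs] u v0 yu yv0 /=.
  move=> _; rewrite [X in (X + _)%N = _](_ : _ = 0%N) ?add0n; last first.
    case: u yu => // a u; rewrite inE negb_or eq_sym => /andP[/negPf -> _].
    by rewrite mul0n.
  case: v0 yv0 => [|b v0] /=; first by rewrite eqxx.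
  by rewrite inE negb_or eq_sym => /andP[/negPf -> _].
case: v0 yv0 => //= b v0 ybv0 sv0.
have yv0 : y \notin v0 by move: ybv0; rewrite inE negb_or => /andP[].
rewrite IHs // eqseq_cons -mulnb mulnA eq_sym.
case: u yu => [|a u] // yau; have yu : y \notin u.
  by move: yau; rewrite inE negb_or => /andP[].
rewrite -cat_cons IHs //; last exact: leqW.
have /negPf -> : s != b :: v0 by apply: contraTneq sv0 => ->; rewrite /= ltnn.
by rewrite mul0n muln0.
Qed.

Lemma shcoef_prefix y u v0 v1 t : y \notin u -> y \notin v0 ->
  shcoef u (v0 ++ y :: v1) (v0 ++ y :: t) = shcoef u v1 t.
Proof. by move=> yu yv0; rewrite shcoef_prefix_le // eqxx mul1n. Qed.

Lemma split_count1 y u : count_mem y u = 1%N ->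
  exists u0 u1, [/\ u = u0 ++ y :: u1, y \notin u0 & y \notin u1].
Proof.
move=> cy; have yu : y \in u by rewrite -has_pred1 has_count cy.
case/splitPr: u / yu cy => u0 u1 cy; exists u0, u1; move: cy.
by rewrite count_cat /= eqxx => cy; split=> //; apply/count_memPn; lia.
Qed.

End ShuffleCoefficients.

(** * Counting letters that occur once *)

Section Letters.
Variable A : finType.
Implicit Types (y : A) (s u v : seq A) (D : {set A}).

Definition letters s : {set A} := [set a in s].

Lemma size_sum_count s : size s = (\sum_(a : A) count_mem a s)%N.
Proof.
elim: s => [|b s IHs] /=; first by rewrite big1.
rewrite big_split /= -IHs (bigD1 b) //= eqxx big1 // => a.
by rewrite eq_sym => /negPf ->.
Qed.

(** Otherwise each letter of [D] would take two places of [s] and each other letter of [s] at least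
    one. *)
Lemma exists_count1 s D : D \subset s ->
  (size s < 2 * #|D| + #|letters s :\: D|)%N ->
  exists2 y, y \in D & count_mem y s = 1%N.
Proof.
move=> sD ltsD.
suff /exists_inP[y yD /eqP cy] : [exists y in D, count_mem y s == 1%N].
  by exists y.
move: ltsD; apply: contraTT => /exists_inPn nD.
rewrite -leqNgt size_sum_count mulnC -sum_nat_const -sum1_card.
rewrite (big_mkcond (mem D)) [X in (_ + X)%N]big_mkcond -big_split /=.
apply: leq_sum => a _; rewrite !inE; case: ifPn => [aD|_] /=.
  have := subsetP sD a aD; rewrite -has_pred1 has_count.
  by move: (nD a aD); case: (count_mem a s) => [|[|n]].
by rewrite -has_pred1 has_count; case: (count_mem a s).
Qed.

Lemma letters_cat u v : letters (u ++ v) = letters u :|: letters v.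
Proof. by apply/setP => a; rewrite !inE mem_cat. Qed.

Lemma letters_cons y u : letters (y :: u) = y |: letters u.
Proof. by apply/setP => a; rewrite !inE. Qed.

End Letters.

(** * Words whose shuffle vanishes over K *)

Section ShuffleZero.
Variables (K : nzRingType) (A : finType).
Implicit Types (y : A) (t u v : seq A).

Definition shuffle0 u v := forall t, (shcoef u v t)%:R = 0 :> K.

Lemma shuffle0C u v : shuffle0 u v -> shuffle0 v u.
Proof. by move=> uv0 t; rewrite shcoefC. Qed.

Lemma shuffle0_common u v : shuffle0 u v -> has (mem u) v.
Proof.
move=> uv0; apply: contraT => /shcoef_cat uv1.
by have /eqP := uv0 (u ++ v); rewrite uv1 oner_eq0.
Qed.

Lemma shuffle0_split y u v0 v1 :
  y \notin u -> y \notin v0 -> y \notin v1 ->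
  shuffle0 u (v0 ++ y :: v1) -> shuffle0 u v0 /\ shuffle0 u v1.
Proof.
move=> yu yv0 yv1 uv; split=> t.
  by rewrite -(@shcoef_suffix _ y u v0 v1).
by rewrite -(@shcoef_prefix _ y u v0 v1).
Qed.

Lemma shuffle0_card_setD u v :
  shuffle0 u v -> (2 * #|letters v :\: letters u| < size v)%N.
Proof.
have [n] := ubnP (size v); elim: n v => // n IHn v /ltnSE le_v_n uv.
rewrite ltnNge; apply/negP => le_v.
have [b bv /= bu] := hasP (shuffle0_common uv).
(* The shared letter supplies the strict inequality required by [exists_count1]. *)
have bI : (0 < #|letters v :&: letters u|)%N.
  by apply/card_gt0P; exists b; rewrite !inE bv.
have [||y] := @exists_count1 _ v (letters v :\: letters u).
- by apply/subsetP => a; rewrite !inE => /andP[].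
- by rewrite setDDr setDv set0U; lia.
rewrite !inE => /andP[yu yv] /split_count1[v0 [v1 [v_eq yv0 yv1]]].
have [uv0 uv1] : shuffle0 u v0 /\ shuffle0 u v1.
  by apply: (@shuffle0_split y) => //; rewrite -v_eq.
move: le_v le_v_n; rewrite v_eq letters_cat letters_cons size_cat /=.
rewrite !setDUl => le_v le_v_n.
(* Each strict bound gains 1 and y itself fills one place: together 3, against the 2 that y adds to
   twice the number of new letters. *)
have := IHn v0 ltac:(lia) uv0; have := IHn v1 ltac:(lia) uv1.
move: le_v; rewrite setUCA.
set D0 := letters v0 :\: _; set D1 := letters v1 :\: _.
have : (#|[set y] :\: letters u| <= 1)%N.
  by rewrite -(cards1 y) subset_leq_card // subsetDl.
have := (leq_card_setU ([set y] :\: letters u) (D0 :|: D1)).1.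
by have := (leq_card_setU D0 D1).1; lia.
Qed.

Lemma shuffle0_card_split y u v : y \notin u -> count_mem y v = 1%N ->
  (forall v', size v' < size v -> shuffle0 u v' ->
     2 * #|letters (u ++ v')| <= size (u ++ v'))%N ->
  (size u < 2 * #|letters u|)%N ->
  shuffle0 u v -> (2 * #|letters (u ++ v)| <= size (u ++ v))%N.
Proof.
move=> yu /split_count1[v0 [v1 [-> yv0 yv1]]] IH eu uv.
have [uv0 uv1] := shuffle0_split yu yv0 yv1 uv.
have := IH _ _ uv0; have := IH _ _ uv1.
rewrite !letters_cat letters_cons !size_cat /=.
move=> /(_ ltac:(lia)) le1 /(_ ltac:(lia)) le0.
(* Summing [le0] and [le1] counts the letters of [u] twice; since [size u < 2 * #|letters u|], this
   surplus absorbs the second copy of [u] and the loss of y. *)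
have := cardsUI (letters u :|: letters v0) (letters u :|: letters v1).
have : (#|letters u| <=
    #|(letters u :|: letters v0) :&: (letters u :|: letters v1)|)%N.
  by rewrite -setUIr subset_leq_card // subsetUl.
have := (leq_card_setU [set y]
  ((letters u :|: letters v0) :|: (letters u :|: letters v1))).1.
rewrite cards1 -setUUr [letters v0 :|: (_ |: _)]setUCA.
by rewrite [letters u :|: (_ |: _)]setUCA; lia.
Qed.

Lemma shuffle0_card u v :
  shuffle0 u v -> (2 * #|letters (u ++ v)| <= size (u ++ v))%N.
Proof.
have [n] := ubnP (size u + size v).
elim: n u v => // n IHn u v /ltnSE le_uv_n uv.
rewrite leqNgt; apply/negP => lt_uv.
have vu := shuffle0C uv.
have lettersC s t : letters (s ++ t) = letters (t ++ s).
  by rewrite !letters_cat setUC.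
(* Fewer than half as many new letters as places come from [t], so dropping [t] keeps the excess
   positive. *)
have pos s t : shuffle0 s t -> (size (s ++ t) < 2 * #|letters (s ++ t)|)%N ->
    (size s < 2 * #|letters s|)%N.
  move=> /shuffle0_card_setD ltD; rewrite letters_cat size_cat.
  have := cardsUI (letters s) (letters t :\: letters s).
  by rewrite setDE setUIr setUCr setIT setICA setICr setI0 cards0 -setDE; lia.
have eu := pos _ _ uv lt_uv.
have ev : (size v < 2 * #|letters v|)%N.
  by apply: pos vu _; rewrite lettersC size_cat addnC -size_cat.
have [||y _] := @exists_count1 _ (u ++ v) (letters (u ++ v)).
- by apply/subsetP => a; rewrite inE.
- by lia.
rewrite count_cat => cy.
have [yu|yu] := boolP (y \in u).
  have yu1 : (0 < count_mem y u)%N by rewrite -has_count has_pred1.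
  have yv : y \notin v by apply/count_memPn; lia.
  have := @shuffle0_card_split y v u yv ltac:(lia) _ ev vu.
  rewrite lettersC size_cat addnC -size_cat leqNgt lt_uv.
  move=> /(_ _)/negP; case=> //.
  by move=> u' lt_u' /IHn; apply; lia.
have := count_memPn yu => cyu.
have := @shuffle0_card_split y u v yu ltac:(lia) _ eu uv.
rewrite leqNgt lt_uv => /(_ _)/negP; case=> //.
by move=> v' lt_v' /IHn; apply; lia.
Qed.

End ShuffleZero.

(** * From Lie brackets to shuffles *)

Section Lie.
Variables (K : nzRingType) (A : finType).
Implicit Types (x : A) (t u v : seq A).

(** The outermost bracket puts the head of [t] at the far left, with sign -1, or at the far right:
    it is the head of [u] or of [v], as in the recursion of [shcoef]. The reversals make both ends
    heads. *)
Lemma mcoeff_lie_rev x u v t : x \notin u -> x \notin v -> x \notin t ->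
  (lie (K := K) << FMonom (x :: rev t) >>)@_(FMonom (u ++ x :: rev v)) =
  (-1) ^+ size u * (shcoef u v t)%:R.
Proof.
elim: t u v => [|z t IHt] u v xu xv /=.
  move=> _; rewrite lie_letter /letter mcoeffU FMonom_eq.
  case: u xu => [|a u] /=; last first.
    rewrite inE negb_or eqseq_cons => /andP[/negPf -> _].
    by rewrite mulr0.
  rewrite expr0 mul1r eqseq_cons eqxx /=.
  by case: v {xv} => // b v; rewrite rev_cons; case: (rev v).
rewrite inE negb_or => /andP[xz xt].
rewrite rev_cons -rcons_cons lie_rcons // mcoeffB natrD mulrDr addrC.
congr (_ + _).
  case: u xu => [|a u] xu.
    rewrite [X in - X]mcoeffMl_letter eq_sym (negPf xz) mulr0n oppr0.
    exact: esym (mulr0 _).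
  move: xu; rewrite inE negb_or => /andP[_ xu].
  rewrite [X in - X]mcoeffMl_letter [X in - (X *+ _)]IHt // eq_sym /= exprS.
  case: (a == z); first by rewrite mul1n mulN1r mulNr.
  by rewrite mul0n mulr0 mulr0n oppr0.
case: v xv => [|b v] xv.
  rewrite cats1 [LHS]mcoeffMr_letter eq_sym (negPf xz) mulr0n.
  exact: esym (mulr0 _).
move: xv; rewrite inE negb_or => /andP[_ xv].
rewrite rev_cons -rcons_cons -rcons_cat [LHS]mcoeffMr_letter.
rewrite [X in X *+ _]IHt // eq_sym.
by case: (b == z); rewrite ?mul1n ?mul0n ?mulr0.
Qed.

Lemma lstar0_shuffle0 x u v : x \notin u -> x \notin v ->
  lstar (K := K) << FMonom (u ++ x :: v) >> = 0 -> shuffle0 K u (rev v).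
Proof.
move=> xu xv w0 t; have xv' : x \notin rev v by rewrite mem_rev.
have [xt|xt] := boolP (x \in t); first by rewrite (@shcoef_notin _ x).
have := mcoeff_lie_rev xu xv' xt.
rewrite revK -lstarE w0 mcoeff0 => c0.
by apply: (can_inj (signrMK (size u))); rewrite /= -c0 mulr0.
Qed.

End Lie.

Theorem theorem3p3 (K : comNzRingType) (A : finType) (w : {fmonom A}) :
  lstar (K := K) << w >> = 0 -> (#|alph w| <= uphalf (fdeg w))%N.
Proof.
case: w => s w0; rewrite leqNgt -[alph _]/(letters s) -[fdeg _]/(@size A s).
apply/negP => lt_s.
have [||x _] := @exists_count1 _ s (letters s).
- by apply/subsetP => a; rewrite inE.
(* By the rounding, failure of the bound means an excess of at least 2, which leaves at least 1 once
   x is removed. *)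
- by move: lt_s; rewrite uphalf_half; lia.
case/split_count1 => u [v [s_eq xu xv]].
rewrite {s}s_eq in w0 lt_s.
have := shuffle0_card (lstar0_shuffle0 xu xv w0).
have := (leq_card_setU [set x] (letters u :|: letters (rev v))).1.
move: lt_s; rewrite !letters_cat letters_cons setUCA !size_cat size_rev.
rewrite uphalf_half /= cards1.
have -> : letters (rev v) = letters v by apply/setP => a; rewrite !inE mem_rev.
lia.
Qed.
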